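(* Let $r>0$ be real, let $k_r$ be the singular modulus, $a(r)$ the elliptic alpha function, $\beta_r$ as in the context, and let $\alpha_5(r)=a_{1/3}(\sqrt{\beta_r})$ be the generalized elliptic alpha function of order $s=1/3$ at $x_r=\sqrt{\beta_r}$. Then $$10\,\alpha_5(r)\,r^{-1/2}=1+8\beta_r-\frac{1+k_r^2-3a(r)r^{-1/2}}{\sqrt{1-k_r^2+k_r^4}} .$$
   Context: $K(x)=\int_0^{\pi/2}\frac{dt}{\sqrt{1-x^2\sin^2 t}}$ and $E(x)=\int_0^{\pi/2}\sqrt{1-x^2\sin^2 t}\,dt$. For $r>0$ the singular modulus $k_r\in(0,1)$ is the unique solution $w$ of $K(\sqrt{1-w^2})/K(w)=\sqrt r$, and $a(r)=\frac{\pi}{4K(k_r)^2}-\sqrt r\left(\frac{E(k_r)}{K(k_r)}-1\right)$. $\beta_r\in(0,1)$ is the unique root $w$ of $\frac{{}_2F_1(\frac16,\frac56;1;1-w)}{{}_2F_1(\frac16,\frac56;1;w)}=\sqrt r$. For $s$ with $0<s<1/2$, $K_s(x)=\frac\pi2\,{}_2F_1(\frac12-s,\frac12+s;1;x^2)$ and $E_s(x)=\frac\pi2\,{}_2F_1(-\frac12-s,\frac12+s;1;x^2)$, and the generalized alpha function at the generalized singular value $x_r$ (here $x_r=\sqrt{\beta_r}$ for $s=1/3$, so that $K_{1/3}(\sqrt{1-x_r^2})/K_{1/3}(x_r)=\sqrt r$) is $$a_s(x_r)=\frac{\pi}{4K_s(x_r)^2}\,\frac{\cos(\pi s)}{1+2s}-\sqrt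 r\left(\frac{E_s(x_r)}{K_s(x_r)}-1\right).$$ *)

(* Defs.v *)
From Stdlib Require Import Reals Lra.
From Coquelicot Require Import Coquelicot.
Open Scope R_scope.

Definition ellK (x : R) : R :=
  RInt (fun t => / sqrt (1 - x ^ 2 * sin t ^ 2)) 0 (PI / 2).
Definition ellE (x : R) : R :=
  RInt (fun t => sqrt (1 - x ^ 2 * sin t ^ 2)) 0 (PI / 2).

Fixpoint poch (a : R) (n : nat) : R :=
  match n with
  | O => 1
  | S m => poch a m * (a + INR m)
  end.

(* Gauss hypergeometric function 2F1(a,b;c;x) as its power series
   sum_n (a)_n (b)_n / ((c)_n n!) x^n  (used only for |x| < 1). *)
Definition F21 (a b c x : R) : R :=
  Series (fun n => poch a n * poch b n / (poch c n * INR (Factorial.fact n)) * x ^ n).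

Definition is_singular_modulus (r k : R) : Prop :=
  0 < k < 1 /\ ellK (sqrt (1 - k ^ 2)) / ellK k = sqrt r.

(* Elliptic alpha function a(r), evaluated at k = k_r. *)
Definition alpha_fun (r k : R) : R :=
  PI / (4 * ellK k ^ 2) - sqrt r * (ellE k / ellK k - 1).

Definition is_beta (r b : R) : Prop :=
  0 < b < 1 /\
  F21 (1/6) (5/6) 1 (1 - b) / F21 (1/6) (5/6) 1 b = sqrt r.

Definition Ks (s x : R) : R := PI / 2 * F21 (1/2 - s) (1/2 + s) 1 (x ^ 2).
Definition Es (s x : R) : R := PI / 2 * F21 (-1/2 - s) (1/2 + s) 1 (x ^ 2).

Definition alpha_s (s r x : R) : R :=
  PI / (4 * Ks s x ^ 2) * (cos (PI * s) / (1 + 2 * s))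
  - sqrt r * (Es s x / Ks s x - 1).

(* Main.v *)
Require Import Defs.
From Stdlib Require Import Reals Lra.
From Coquelicot Require Import Coquelicot.
Open Scope R_scope.

(** With [m = k^2], the pair [F = 2F1(1/6,5/6;1;.)], [G = 2F1(-5/6,5/6;1;.)] evaluated at
    [beta m] satisfies a linear system [y' = u (z - w y)], [z' = u w (z - y)], and so does an
    explicit algebraic combination [(modK, modE)] of the elliptic integrals, whose first component
    is [(1 - m + m^2)^(1/4) K].  The determinant of the two solutions is constant and vanishes at
    [m = 0], so the solutions are proportional.  Proportionality of the first components gives
    [F(beta m) = (2/pi) (1 - m + m^2)^(1/4) K(m)], hence [beta_r = beta (k_r^2)] because
    [beta (1 - m) = 1 - beta m]; proportionality of the second components expresses [E_s / K_s]
    through [E / K], which is the claimed identity. *)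

(** The mean value theorem with mere continuity at the endpoints, because the differential system
    used later is singular at [m = 0]. *)
Lemma zero_derive_const (f : R -> R) (a b : R) (hab : a <= b)
  (hd : forall x, a < x < b -> is_derive f x 0)
  (hc : forall x, a <= x <= b -> continuous f x) : f b = f a.
Proof.
destruct (MVT_gen f a b (fun _ => 0)) as [c [_ Hc]].
- rewrite Rmin_left, Rmax_right by lra. exact hd.
- rewrite Rmin_left, Rmax_right by lra.
  intros x Hx. apply continuity_pt_filterlim, hc, Hx.
- lra.
Qed.

(** * Hypergeometric series: convergence, contiguous relations, monotonicity *)

Definition hyp_coef (a b : R) (n : nat) : R :=
  poch a n * poch b n / (poch 1 n * INR (Factorial.fact n)).

Lemma poch_1 (n : nat) : poch 1 n = INR (Factorial.fact n).
Proof.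
induction n as [|n IH]; [reflexivity|].
cbn [poch]. rewrite IH, fact_simpl, mult_INR, S_INR. ring.
Qed.

Lemma Rabs_poch_le (a : R) (n : nat) (ha : Rabs a <= 1) :
  Rabs (poch a n) <= INR (Factorial.fact n).
Proof.
induction n as [|n IH].
- simpl. rewrite Rabs_R1. lra.
- cbn [poch]. rewrite fact_simpl, mult_INR, S_INR, Rabs_mult, Rmult_comm.
  apply Rmult_le_compat; try apply Rabs_pos; trivial.
  eapply Rle_trans; [apply Rabs_triang|].
  rewrite (Rabs_pos_eq (INR n)) by apply pos_INR. lra.
Qed.

(** For [c = 1] the denominator is [n!^2], and each Pochhammer factor above is at most [n!] in
    absolute value. Bounded coefficients already give convergence on the open unit disc. *)
Lemma hyp_coef_bound (a b : R) (n : nat) (ha : Rabs a <= 1) (hb : Rabs b <= 1) :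
  Rabs (hyp_coef a b n) <= 1.
Proof.
unfold hyp_coef. rewrite poch_1.
assert (Hf := INR_fact_lt_0 n).
unfold Rdiv. rewrite !Rabs_mult, (Rabs_pos_eq (/ _)).
2: { apply Rlt_le, Rinv_0_lt_compat. nra. }
apply Rmult_le_reg_r with (INR (Factorial.fact n) * INR (Factorial.fact n)); [nra|].
rewrite Rmult_assoc, Rinv_l, Rmult_1_r, Rmult_1_l by nra.
apply Rmult_le_compat; try apply Rabs_pos; now apply Rabs_poch_le.
Qed.

Lemma hyp_coef_radius (a b x : R) (ha : Rabs a <= 1) (hb : Rabs b <= 1)
  (hx : Rabs x < 1) : Rbar_lt (Rabs x) (CV_radius (hyp_coef a b)).
Proof.
apply Rbar_lt_le_trans with (Finite 1); [exact hx|].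
apply (proj1 (CV_radius_bounded (hyp_coef a b))).
exists 1. intros n. rewrite pow1, Rmult_1_r. now apply hyp_coef_bound.
Qed.

Lemma is_derive_F21 (a b x : R) (ha : Rabs a <= 1) (hb : Rabs b <= 1)
  (hx : Rabs x < 1) :
  is_derive (F21 a b 1) x (PSeries (PS_derive (hyp_coef a b)) x).
Proof.
apply (is_derive_PSeries (hyp_coef a b)). now apply hyp_coef_radius.
Qed.

Lemma F21_0 (a b c : R) : F21 a b c 0 = 1.
Proof.
change (PSeries (fun n => poch a n * poch b n / (poch c n * INR (Factorial.fact n))) 0 = 1).
rewrite PSeries_0. simpl. field.
Qed.

Lemma hyp_coef_S (a b : R) (n : nat) :
  (INR n + 1) ^ 2 * hyp_coef a b (S n) = (a + INR n) * (b + INR n) * hyp_coef a b n.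
Proof.
unfold hyp_coef. rewrite !poch_1. cbn [poch]. rewrite fact_simpl, mult_INR, S_INR.
assert (Hf := INR_fact_lt_0 n). assert (Hn := pos_INR n). field. lra.
Qed.

(** Both sides are [poch (a - 1) (S n)], with the last or the first factor split off. *)
Lemma poch_shift (a : R) (n : nat) : (a - 1 + INR n) * poch (a - 1) n = (a - 1) * poch a n.
Proof.
induction n as [|n IH]; [simpl; ring|].
cbn [poch]. rewrite S_INR.
replace ((a - 1 + (INR n + 1)) * (poch (a - 1) n * (a - 1 + INR n)))
  with ((a + INR n) * ((a - 1 + INR n) * poch (a - 1) n)) by ring.
rewrite IH. ring.
Qed.

Lemma hyp_coef_lower (a b : R) (n : nat) :
  (a - 1 + INR n) * hyp_coef (a - 1) b n = (a - 1) * hyp_coef a b n.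
Proof.
unfold hyp_coef, Rdiv. rewrite <- !Rmult_assoc, poch_shift. reflexivity.
Qed.

Lemma PS_incr_derive (c : nat -> R) (n : nat) :
  PS_incr_1 (PS_derive c) n = INR n * c n.
Proof.
destruct n as [|n]; [|reflexivity]. simpl. unfold zero; simpl. ring.
Qed.

Lemma ex_pseries_derive (c : nat -> R) (x : R) (hx : Rbar_lt (Rabs x) (CV_radius c)) :
  ex_pseries (PS_derive c) x.
Proof. apply CV_radius_inside. now rewrite CV_radius_derive. Qed.

(** Coefficientwise, [n g_n = b (g_n - c_n)] is [hyp_coef_lower] at [a = 1 - b]. *)
Lemma F21_lower_derive (b x : R) (hb : 0 < b < 1) (hx : Rabs x < 1) :
  x * Derive (F21 (- b) b 1) x = b * (F21 (- b) b 1 x - F21 (1 - b) b 1 x).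
Proof.
assert (H1 : Rabs (- b) <= 1) by (rewrite Rabs_Ropp, Rabs_pos_eq; lra).
assert (H2 : Rabs b <= 1) by (rewrite Rabs_pos_eq; lra).
assert (H3 : Rabs (1 - b) <= 1) by (rewrite Rabs_pos_eq; lra).
rewrite (is_derive_unique _ _ _ (is_derive_F21 (- b) b x H1 H2 hx)).
rewrite <- PSeries_incr_1.
change (F21 (- b) b 1 x) with (PSeries (hyp_coef (- b) b) x).
change (F21 (1 - b) b 1 x) with (PSeries (hyp_coef (1 - b) b) x).
rewrite <- PSeries_minus by (apply CV_radius_inside; now apply hyp_coef_radius).
rewrite <- PSeries_scal.
apply PSeries_ext. intros n. rewrite PS_incr_derive.
unfold PS_scal, PS_minus, PS_plus, PS_opp, plus, opp, scal; simpl; unfold mult; simpl.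
assert (H := hyp_coef_lower (1 - b) b n).
replace (1 - b - 1) with (- b) in H by ring. lra.
Qed.

(* The coefficients [d_n = (n + b) c_n] of [x F' + b F] satisfy [d_(n+1) - d_n = b g_(n+1)],
   where [c] and [g] are the coefficients of the two series. *)
Lemma F21_derive (b x : R) (hb : 0 < b < 1) (hx : Rabs x < 1) :
  x * (1 - x) * Derive (F21 (1 - b) b 1) x =
  b * (F21 (- b) b 1 x - (1 - x) * F21 (1 - b) b 1 x).
Proof.
assert (H1 : Rabs (- b) <= 1) by (rewrite Rabs_Ropp, Rabs_pos_eq; lra).
assert (H2 : Rabs b <= 1) by (rewrite Rabs_pos_eq; lra).
assert (H3 : Rabs (1 - b) <= 1) by (rewrite Rabs_pos_eq; lra).
rewrite (is_derive_unique _ _ _ (is_derive_F21 (1 - b) b x H3 H2 hx)).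
change (F21 (- b) b 1 x) with (PSeries (hyp_coef (- b) b) x).
change (F21 (1 - b) b 1 x) with (PSeries (hyp_coef (1 - b) b) x).
set (c := hyp_coef (1 - b) b). set (g := hyp_coef (- b) b).
assert (Hc : Rbar_lt (Rabs x) (CV_radius c)) by now apply hyp_coef_radius.
assert (Hc' : ex_pseries c x) by now apply CV_radius_inside.
assert (Hd : ex_pseries (PS_derive c) x) by now apply ex_pseries_derive.
assert (Hi : ex_pseries (PS_incr_1 (PS_derive c)) x) by now apply ex_pseries_incr_1.
assert (Hs : ex_pseries (PS_scal b c) x).
{ apply ex_pseries_scal; [apply Rmult_comm|exact Hc']. }
set (h := PS_plus (PS_incr_1 (PS_derive c)) (PS_scal b c)).
assert (Hh : ex_pseries h x) by now apply ex_pseries_plus.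
assert (E : PSeries h x = x * PSeries (PS_derive c) x + b * PSeries c x).
{ unfold h. rewrite PSeries_plus, PSeries_incr_1, PSeries_scal by assumption. reflexivity. }
enough (E2 : PSeries h x - x * PSeries h x = b * PSeries g x) by (rewrite E in E2; lra).
rewrite <- PSeries_incr_1, <- PSeries_minus, <- PSeries_scal; trivial.
2: now apply ex_pseries_incr_1.
apply PSeries_ext. intros n.
unfold h, PS_scal, PS_minus, PS_plus, PS_opp, plus, opp, scal; cbn -[PS_incr_1 PS_derive INR];
  unfold mult; cbn -[PS_incr_1 PS_derive INR].
rewrite PS_incr_derive.
destruct n as [|n].
{ simpl. unfold c, g, hyp_coef, zero; simpl. field. }
change (PS_incr_1 (fun n0 => PS_incr_1 (PS_derive c) n0 + b * c n0) (S n))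
  with (PS_incr_1 (PS_derive c) n + b * c n).
rewrite PS_incr_derive, S_INR.
assert (HS := hyp_coef_S (1 - b) b n). fold c in HS.
assert (HL := hyp_coef_lower (1 - b) b (S n)). fold c in HL.
replace (1 - b - 1) with (- b) in HL by ring. fold g in HL. rewrite S_INR in HL.
assert (Hn := pos_INR n).
(* The factor [n + 1 - b] is positive since [b < 1]; it turns [g_(n+1)] into a multiple of
   [c_(n+1)], and the recurrence for [c] finishes. *)
apply Rmult_eq_reg_l with (- b + (INR n + 1)); [|lra].
replace ((- b + (INR n + 1)) * (b * g (S n))) with (b * ((- b + (INR n + 1)) * g (S n))) by ring.
rewrite HL. nra.
Qed.

Lemma hyp_coef_pos (a b : R) (n : nat) (ha : 0 < a) (hb : 0 < b) : 0 < hyp_coef a b n.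
Proof.
assert (Hp : forall c, 0 < c -> 0 < poch c n).
{ intros c hc. induction n as [|n IH]; cbn [poch]; [lra|].
  apply Rmult_lt_0_compat; [exact IH|]. assert (H := pos_INR n). lra. }
unfold hyp_coef. rewrite poch_1. assert (Hf := INR_fact_lt_0 n).
apply Rdiv_lt_0_compat; apply Rmult_lt_0_compat; auto.
Qed.

(** All coefficients are positive, so the termwise differences are nonnegative; the term of degree
    one makes the inequality strict. *)
Lemma F21_increasing (a b x y : R) (ha : 0 < a <= 1) (hb : 0 < b <= 1)
  (hxy : 0 <= x < y) (hy : y < 1) : F21 a b 1 x < F21 a b 1 y.
Proof.
assert (Hr : forall z, 0 <= z < 1 -> ex_series (fun n => hyp_coef a b n * z ^ n)).
{ intros z Hz. apply ex_pseries_R, CV_radius_inside, hyp_coef_radius;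
    rewrite Rabs_pos_eq; lra. }
assert (Hx := Hr x ltac:(lra)). assert (Hy := Hr y ltac:(lra)).
apply Rlt_0_minus. unfold F21, Rminus.
change (0 < Series (fun n => hyp_coef a b n * y ^ n) - Series (fun n => hyp_coef a b n * x ^ n)).
rewrite <- Series_minus by assumption.
set (u := fun n => hyp_coef a b n * y ^ n - hyp_coef a b n * x ^ n).
assert (Hu : ex_series u) by exact (ex_series_minus _ _ Hy Hx).
assert (Hpos : forall n, 0 <= u n).
{ intros n. unfold u. assert (H := hyp_coef_pos a b n ltac:(lra) ltac:(lra)).
  assert (x ^ n <= y ^ n) by (apply pow_incr; lra). nra. }
rewrite Series_incr_1 by exact Hu.
rewrite Series_incr_1 by now apply (proj1 (ex_series_incr_1 u)).
assert (H1 : 0 < u 1%nat).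
{ unfold u. assert (H := hyp_coef_pos a b 1 ltac:(lra) ltac:(lra)). rewrite !pow_1. nra. }
assert (Ht : 0 <= Series (fun k => u (S (S k)))).
{ rewrite <- (Rmult_0_l (Series u)), <- Series_scal_l.
  apply Series_le.
  { intros n. rewrite Rmult_0_l. split; [lra|apply Hpos]. }
  apply (proj1 (ex_series_incr_1 (fun k => u (S k)))), (proj1 (ex_series_incr_1 u)), Hu. }
assert (H0 := Hpos 0%nat). lra.
Qed.

(** * Complete elliptic integrals and their derivatives in the parameter *)

Lemma modulus_pos (m t : R) (hm : m < 1) : 0 < 1 - m * sin t ^ 2.
Proof.
assert (H := sin2_cos2 t). unfold Rsqr in H.
assert (0 <= cos t * cos t) by apply Rle_0_sqr.
assert (0 <= sin t * sin t) by apply Rle_0_sqr.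
destruct (Rle_dec m 0); nra.
Qed.

Lemma ex_RInt_modulus (f g : R -> R) (m : R) (hm : m < 1)
  (hf : forall v, 0 < v -> continuous f v) (hg : forall t, continuous g t) :
  ex_RInt (fun t => g t * f (1 - m * sin t ^ 2)) 0 (PI / 2).
Proof.
apply (ex_RInt_continuous (V := R_CompleteNormedModule)). intros t _.
apply (continuous_mult g); [apply hg|].
apply (continuous_comp (fun t => 1 - m * sin t ^ 2) f).
- apply (ex_derive_continuous (V := R_NormedModule)). auto_derive. trivial.
- apply hf, modulus_pos, hm.
Qed.

(** Differentiation under the integral sign: for parameters below 1 the argument of [f] stays
    positive, which makes the partial derivative jointly continuous. A general [f] serves both
    [sqrt] and its inverse. *)
Lemma is_derive_modulus_integral (f df : R -> R) (m : R) (hm : m < 1)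
  (hf : forall v, 0 < v -> is_derive f v (df v))
  (hdf : forall v, 0 < v -> continuous df v) :
  is_derive (fun m => RInt (fun t => f (1 - m * sin t ^ 2)) 0 (PI / 2)) m
    (RInt (fun t => - sin t ^ 2 * df (1 - m * sin t ^ 2)) 0 (PI / 2)).
Proof.
assert (Hd : forall m t, m < 1 ->
  is_derive (fun u => f (1 - u * sin t ^ 2)) m (- sin t ^ 2 * df (1 - m * sin t ^ 2))).
{ intros u t Hu. apply (is_derive_comp f (fun u => 1 - u * sin t ^ 2)).
  - apply hf, modulus_pos, Hu.
  - auto_derive; [trivial|ring]. }
assert (Hl : locally m (fun y => y < 1)) by (apply open_lt, hm).
rewrite (RInt_ext _ (fun t => Derive (fun u => f (1 - u * sin t ^ 2)) m)).
2: { intros t _. symmetry. now apply is_derive_unique, Hd. }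
apply (is_derive_RInt_param (fun u t => f (1 - u * sin t ^ 2))).
- eapply filter_imp; [|exact Hl]. intros y Hy t _. eexists. now apply Hd.
- intros t _.
  (* The closed form of the partial derivative is valid for [u < 1], hence the neighbourhood of
     radius [1 - m]. *)
  apply continuity_2d_pt_ext_loc with (fun u v => - sin v ^ 2 * df (1 - u * sin v ^ 2)).
  { assert (Hp : 0 < 1 - m) by lra. exists (mkposreal _ Hp). simpl.
    intros u v Hu _. symmetry. apply is_derive_unique, Hd.
    apply Rabs_lt_between in Hu. lra. }
  assert (Hs : continuity_2d_pt (fun _ v => sin v ^ 2) m t).
  { apply (continuity_1d_2d_pt_comp (fun v => sin v ^ 2)).
    - apply continuity_pt_filterlim, (ex_derive_continuous (V := R_NormedModule)).
      auto_derive. trivial.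
    - apply continuity_2d_pt_id2. }
  apply continuity_2d_pt_mult; [now apply continuity_2d_pt_opp|].
  apply (continuity_1d_2d_pt_comp df).
  + apply continuity_pt_filterlim, hdf, modulus_pos, hm.
  + apply continuity_2d_pt_minus; [apply continuity_2d_pt_const|].
    apply continuity_2d_pt_mult; [apply continuity_2d_pt_id1|exact Hs].
- eapply filter_imp; [|exact Hl]. intros y Hy.
  eapply ex_RInt_ext.
  2: apply (ex_RInt_modulus f (fun _ => 1) y Hy).
  + intros t _. apply Rmult_1_l.
  + intros v Hv. apply (ex_derive_continuous (V := R_NormedModule)). eexists. now apply hf.
  + intros t. apply continuous_const.
Qed.

(* The parameter is [m = k^2], so that both integrals are differentiable at [m = 0]. *)
Definition intK (m : R) : R := RInt (fun t => / sqrt (1 - m * sin t ^ 2)) 0 (PI / 2).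
Definition intE (m : R) : R := RInt (fun t => sqrt (1 - m * sin t ^ 2)) 0 (PI / 2).

Lemma continuous_inv_sqrt (v : R) (hv : 0 < v) : continuous (fun v => / sqrt v) v.
Proof.
apply (ex_derive_continuous (V := R_NormedModule)). auto_derive.
assert (H := sqrt_lt_R0 v hv). lra.
Qed.

Lemma continuous_sqrt_pos (v : R) (hv : 0 < v) : continuous sqrt v.
Proof. apply (ex_derive_continuous (V := R_NormedModule)). auto_derive. exact hv. Qed.

Lemma continuous_inv_sqrt_cube (v : R) (hv : 0 < v) :
  continuous (fun v => - / (2 * sqrt v ^ 3)) v.
Proof.
apply (ex_derive_continuous (V := R_NormedModule)). auto_derive.
assert (H := sqrt_lt_R0 v hv). repeat split; trivial.
assert (0 < sqrt v ^ 3) by now apply pow_lt. lra.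
Qed.

Lemma ex_RInt_modulus1 (f : R -> R) (m : R) (hm : m < 1)
  (hf : forall v, 0 < v -> continuous f v) :
  ex_RInt (fun t => f (1 - m * sin t ^ 2)) 0 (PI / 2).
Proof.
eapply ex_RInt_ext; [|apply (ex_RInt_modulus f (fun _ => 1) m hm hf)].
- intros t _. apply Rmult_1_l.
- intros t. apply continuous_const.
Qed.

Lemma intK_0 : intK 0 = PI / 2.
Proof.
unfold intK. rewrite (RInt_ext _ (fun _ => 1)).
- rewrite RInt_const. unfold scal; simpl; unfold mult; simpl. ring.
- intros t _. rewrite Rmult_0_l, Rminus_0_r, sqrt_1. apply Rinv_1.
Qed.

Lemma intE_0 : intE 0 = PI / 2.
Proof.
unfold intE. rewrite (RInt_ext _ (fun _ => 1)).
- rewrite RInt_const. unfold scal; simpl; unfold mult; simpl. ring.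
- intros t _. rewrite Rmult_0_l, Rminus_0_r. apply sqrt_1.
Qed.

Lemma intK_pos (m : R) (hm : m < 1) : 0 < intK m.
Proof.
apply RInt_gt_0.
- assert (H := PI_RGT_0). lra.
- intros t _. apply Rinv_0_lt_compat, sqrt_lt_R0, modulus_pos, hm.
- intros t _. apply (continuous_comp (fun t => 1 - m * sin t ^ 2) (fun v => / sqrt v)).
  + apply (ex_derive_continuous (V := R_NormedModule)). auto_derive. trivial.
  + apply continuous_inv_sqrt, modulus_pos, hm.
Qed.

(** Left as an integral, the derivative makes sense at [m = 0] too, where the closed form divides by
    zero; this gives regularity at the initial point. *)
Lemma is_derive_intE_param (m : R) (hm : m < 1) :
  is_derive intE m (RInt (fun t => - sin t ^ 2 * / (2 * sqrt (1 - m * sin t ^ 2))) 0 (PI / 2)).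
Proof.
apply (is_derive_modulus_integral sqrt (fun v => / (2 * sqrt v)) m hm).
- intros v Hv. auto_derive; [exact Hv|ring].
- intros v Hv. apply (ex_derive_continuous (V := R_NormedModule)). auto_derive.
  assert (H := sqrt_lt_R0 v Hv). split; lra.
Qed.

Lemma is_derive_intK_param (m : R) (hm : m < 1) :
  is_derive intK m
    (RInt (fun t => - sin t ^ 2 * - / (2 * sqrt (1 - m * sin t ^ 2) ^ 3)) 0 (PI / 2)).
Proof.
apply (is_derive_modulus_integral (fun v => / sqrt v) (fun v => - / (2 * sqrt v ^ 3)) m hm).
- intros v Hv. assert (Hs := sqrt_lt_R0 v Hv). auto_derive; [split; lra|field; lra].
- apply continuous_inv_sqrt_cube.
Qed.

(** With [q^2 = 1 - m sin^2 t], the integrand [- sin^2 t / (2 q)] equals [(q - 1/q) / (2 m)]. *)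
Lemma is_derive_intE (m : R) (hm : m < 1) (hm0 : m <> 0) :
  is_derive intE m ((intE m - intK m) / (2 * m)).
Proof.
replace ((intE m - intK m) / (2 * m)) with
  (RInt (fun t => - sin t ^ 2 * / (2 * sqrt (1 - m * sin t ^ 2))) 0 (PI / 2)); [now apply is_derive_intE_param|].
apply is_RInt_unique.
apply is_RInt_ext with (fun t => / (2 * m) *
  (sqrt (1 - m * sin t ^ 2) - / sqrt (1 - m * sin t ^ 2))).
{ intros t _. assert (Hp := modulus_pos m t hm). assert (Hs := sqrt_lt_R0 _ Hp).
  assert (Hq : sqrt (1 - m * sin t ^ 2) * sqrt (1 - m * sin t ^ 2) = 1 - m * sin t ^ 2)
    by (apply sqrt_sqrt; lra).
  set (q := sqrt (1 - m * sin t ^ 2)) in *.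
  match goal with |- ?x = ?y => change (@eq R x y) end.
  replace (sin t ^ 2) with ((1 - q * q) / m).
  - field. lra.
  - rewrite Hq. field. exact hm0. }
replace ((intE m - intK m) / (2 * m)) with (/ (2 * m) * (intE m - intK m)) by (field; exact hm0).
apply (is_RInt_scal (V := R_NormedModule)).
apply (is_RInt_minus (V := R_NormedModule)); apply (RInt_correct (V := R_CompleteNormedModule)).
- apply (ex_RInt_modulus1 sqrt m hm), continuous_sqrt_pos.
- apply (ex_RInt_modulus1 (fun v => / sqrt v) m hm), continuous_inv_sqrt.
Qed.

(* Integration by parts against [sin t cos t / sqrt (1 - m sin^2 t)], which vanishes at both ends. *)
Lemma is_derive_intK (m : R) (hm : m < 1) (hm0 : m <> 0) :
  is_derive intK m ((intE m - (1 - m) * intK m) / (2 * m * (1 - m))).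
Proof.
set (D := fun t => - sin t ^ 2 * - / (2 * sqrt (1 - m * sin t ^ 2) ^ 3)).
assert (HD : is_RInt D 0 (PI / 2) (RInt D 0 (PI / 2))).
{ apply (RInt_correct (V := R_CompleteNormedModule)).
  apply (ex_RInt_modulus (fun v => - / (2 * sqrt v ^ 3)) (fun t => - sin t ^ 2) m hm).
  - apply continuous_inv_sqrt_cube.
  - intros t. apply (ex_derive_continuous (V := R_NormedModule)). auto_derive. trivial. }
assert (HE : is_RInt (fun t => sqrt (1 - m * sin t ^ 2)) 0 (PI / 2) (intE m)).
{ apply (RInt_correct (V := R_CompleteNormedModule)).
  apply (ex_RInt_modulus1 sqrt m hm), continuous_sqrt_pos. }
assert (HK : is_RInt (fun t => / sqrt (1 - m * sin t ^ 2)) 0 (PI / 2) (intK m)).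
{ apply (RInt_correct (V := R_CompleteNormedModule)).
  apply (ex_RInt_modulus1 (fun v => / sqrt v) m hm), continuous_inv_sqrt. }
set (p := fun t => sin t * cos t / sqrt (1 - m * sin t ^ 2)).
set (dp := fun t => (cos t ^ 2 - sin t ^ 2) / sqrt (1 - m * sin t ^ 2)
  + m * sin t ^ 2 * cos t ^ 2 / sqrt (1 - m * sin t ^ 2) ^ 3).
assert (HP : is_RInt dp 0 (PI / 2) 0).
{ replace 0 with (minus (p (PI / 2)) (p 0)) at 2.
  2: { unfold p, minus, plus, opp; simpl. rewrite cos_PI2, sin_0. unfold Rdiv. ring. }
  apply (is_RInt_derive p dp); intros t _; assert (Hp := modulus_pos m t hm);
    assert (Hs := sqrt_lt_R0 _ Hp).
  - unfold p, dp. auto_derive.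
    + replace (1 + - (m * (sin t * (sin t * 1)))) with (1 - m * sin t ^ 2) by ring.
      repeat split; trivial; lra.
    + replace (1 + - (m * (sin t * (sin t * 1)))) with (1 - m * sin t ^ 2) by ring.
      field. lra.
  - unfold dp. apply (ex_derive_continuous (V := R_NormedModule)). auto_derive.
    replace (1 + - (m * (sin t * (sin t * 1)))) with (1 - m * sin t ^ 2) by ring.
    replace (1 + - (m * (sin t * (sin t * 1)))) with (1 - m * sin t ^ 2) by ring.
    repeat split; trivial; try lra. exact (Rgt_not_eq _ _ (pow_lt _ 3 Hs)). }
(* The combination [2 m (1 - m) D + (1 - m) / q - q + m dp], with [q] the square root, vanishes
   identically; integrating it yields the integral of [D]. *)
assert (Hcomb := is_RInt_plus (V := R_NormedModule) _ _ _ _ _ _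
   (is_RInt_scal (V := R_NormedModule) _ _ _ (2 * m * (1 - m)) _ HD)
   (is_RInt_plus (V := R_NormedModule) _ _ _ _ _ _
     (is_RInt_minus (V := R_NormedModule) _ _ _ _ _ _
        (is_RInt_scal (V := R_NormedModule) _ _ _ (1 - m) _ HK) HE)
     (is_RInt_scal (V := R_NormedModule) _ _ _ m _ HP))).
assert (H0 : is_RInt (fun _ => 0) 0 (PI / 2)
   (2 * m * (1 - m) * RInt D 0 (PI / 2) + ((1 - m) * intK m - intE m + m * 0))).
{ eapply is_RInt_ext; [|exact Hcomb].
  intros t _. unfold D, dp, plus, minus, opp, scal; cbn -[pow]; unfold mult; cbn -[pow].
  assert (Hp := modulus_pos m t hm). assert (Hs := sqrt_lt_R0 _ Hp).
  assert (Hq : sqrt (1 - m * sin t ^ 2) ^ 2 = 1 - m * sin t ^ 2)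
    by (rewrite pow2_sqrt; lra).
  assert (Hc : cos t ^ 2 = 1 - sin t ^ 2)
    by (assert (Hc := sin2_cos2 t); unfold Rsqr in Hc; lra).
  rewrite Hc.
  set (q := sqrt (1 - m * sin t ^ 2)) in *. unfold plus; simpl plus.
  apply Rmult_eq_reg_r with (q ^ 3); [|assert (H3 := pow_lt _ 3 Hs); lra].
  field_simplify; [|lra].
  replace (q ^ 4) with ((q ^ 2) ^ 2) by ring. rewrite !Hq. ring. }
apply (is_RInt_unique (V := R_CompleteNormedModule)) in H0. rewrite RInt_const in H0.
unfold scal in H0; simpl in H0; unfold mult in H0; simpl in H0.
replace ((intE m - (1 - m) * intK m) / (2 * m * (1 - m))) with (RInt D 0 (PI / 2)); [now apply is_derive_intK_param|].
apply Rmult_eq_reg_r with (2 * m * (1 - m)); [|nra].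
transitivity (intE m - (1 - m) * intK m); [lra|field; lra].
Qed.

(** * Proportionality of solutions of the linear system *)

(** Primes mark the second solution. The system matrix has trace zero, so the determinant
    [y z' - y' z] is constant, and it vanishes at 0. The derivative of [y / y'] is [- u / y'^2]
    times this determinant. The equations are used only in the open interval, so [u] may blow up at
    0. *)
Lemma linear_system_unique (u w y z y' z' : R -> R) (x : R) (hx : 0 <= x)
  (cy : forall t, 0 <= t <= x -> continuous y t)
  (cz : forall t, 0 <= t <= x -> continuous z t)
  (cy' : forall t, 0 <= t <= x -> continuous y' t)
  (cz' : forall t, 0 <= t <= x -> continuous z' t)
  (dy : forall t, 0 < t < x -> is_derive y t (u t * (z t - w t * y t)))
  (dz : forall t, 0 < t < x -> is_derive z t (u t * w t * (z t - y t)))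
  (dy' : forall t, 0 < t < x -> is_derive y' t (u t * (z' t - w t * y' t)))
  (dz' : forall t, 0 < t < x -> is_derive z' t (u t * w t * (z' t - y' t)))
  (hpos : forall t, 0 <= t <= x -> 0 < y' t)
  (h0 : y 0 = z 0) (h0' : y' 0 = z' 0) :
  y x * z' x = y' x * z x /\ y x / y' x = y 0 / y' 0.
Proof.
assert (HW : forall t, 0 <= t <= x -> y t * z' t - y' t * z t = 0).
{ intros t Ht.
  transitivity (y 0 * z' 0 - y' 0 * z 0); [|rewrite h0, h0'; ring].
  apply (zero_derive_const (fun t => y t * z' t - y' t * z t)); [lra| |].
  - intros s Hs.
    assert (D1 := is_derive_mult y z' s _ _ (dy s ltac:(lra)) (dz' s ltac:(lra)) Rmult_comm).
    assert (D2 := is_derive_mult y' z s _ _ (dy' s ltac:(lra)) (dz s ltac:(lra)) Rmult_comm).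
    assert (D := is_derive_minus _ _ _ _ _ D1 D2).
    evar_last; [exact D|].
    unfold minus, plus, opp, mult; simpl. ring.
  - intros s Hs. apply (continuous_minus (fun s => y s * z' s) (fun s => y' s * z s)).
    + apply (continuous_mult y z'); [apply cy|apply cz']; lra.
    + apply (continuous_mult y' z); [apply cy'|apply cz]; lra. }
split; [specialize (HW x ltac:(lra)); lra|].
apply (zero_derive_const (fun t => y t / y' t)); [lra| |].
- intros s Hs. assert (Hp := hpos s ltac:(lra)).
  evar_last.
  { apply is_derive_div; [apply dy; lra|apply dy'; lra|lra]. }
  simpl. assert (H := HW s ltac:(lra)).
  replace (_ - _) with (- u s * (y s * z' s - y' s * z s)) by ring.
  rewrite H. field. lra.
- intros s Hs. assert (Hp := hpos s ltac:(lra)).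
  apply (continuous_mult y (fun s => / y' s)); [apply cy; lra|].
  apply continuous_Rinv_comp; [apply cy'; lra|lra].
Qed.

(** * The algebraic change of parameter *)

Definition root4 (m : R) : R := sqrt (sqrt (1 - m + m ^ 2)).

Lemma root4_pos (m : R) : 0 < root4 m.
Proof. apply sqrt_lt_R0, sqrt_lt_R0. nra. Qed.

Lemma root4_sqr (m : R) : root4 m ^ 2 = sqrt (1 - m + m ^ 2).
Proof. apply pow2_sqrt, sqrt_pos. Qed.

Lemma root4_pow4 (m : R) : root4 m ^ 4 = 1 - m + m ^ 2.
Proof.
replace (root4 m ^ 4) with ((root4 m ^ 2) ^ 2) by ring.
rewrite root4_sqr. apply pow2_sqrt. nra.
Qed.

Lemma is_derive_root4 (m : R) : is_derive root4 m ((2 * m - 1) / (4 * root4 m ^ 3)).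
Proof.
assert (Hp : 0 < 1 - m + m ^ 2) by nra.
assert (Hs := root4_pos m). assert (Hs2 := root4_sqr m). assert (H2 := sqrt_lt_R0 _ Hp).
unfold root4 at 1. evar_last.
{ apply (is_derive_comp sqrt (fun m => sqrt (1 - m + m ^ 2))).
  - apply is_derive_sqrt; [apply is_derive_id|exact H2].
  - apply (is_derive_sqrt (fun m => 1 - m + m ^ 2) m (2 * m - 1)); [|exact Hp].
    auto_derive; [trivial|ring]. }
unfold scal, one; simpl; unfold mult; simpl.
replace (sqrt (1 - m + m * (m * 1))) with (root4 m * root4 m) by (rewrite <- root4_sqr; ring).
rewrite sqrt_square by lra. field. lra.
Qed.

Lemma Derive_root4 (m : R) : Derive (fun t => root4 t) m = (2 * m - 1) / (4 * root4 m ^ 3).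
Proof. apply is_derive_unique, is_derive_root4. Qed.

(* Both parameters have the same [j]-invariant: [4 beta (1 - beta)] and
   [27 m^2 (1 - m)^2 / (4 (1 - m + m^2)^3)] equal [1728 / j]; see [beta_mul]. *)
Definition beta (m : R) : R := 1 / 2 - (1 + m) * (1 - 2 * m) * (2 - m) / (4 * root4 m ^ 6).

Lemma root4_reflect (m : R) : root4 (1 - m) = root4 m.
Proof. unfold root4. do 2 f_equal. ring. Qed.

(** The numerator [(1 + m) (1 - 2 m) (2 - m)] is odd under [m -> 1 - m], while [root4] is
    invariant. *)
Lemma beta_reflect (m : R) : beta (1 - m) = 1 - beta m.
Proof.
unfold beta. rewrite root4_reflect. assert (Hs := root4_pos m). field. lra.
Qed.

(** Rests on [4 (1 - m + m^2)^3 - ((1 + m) (1 - 2 m) (2 - m))^2 = 27 m^2 (1 - m)^2]. *)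
Lemma beta_mul (m : R) : beta m * (1 - beta m) = 27 * m ^ 2 * (1 - m) ^ 2 / (16 * root4 m ^ 12).
Proof.
assert (Hs := root4_pos m). assert (H4 := root4_pow4 m). unfold beta.
field_simplify_eq; [|lra]. replace (root4 m ^ 12) with ((root4 m ^ 4) ^ 3) by ring.
rewrite H4. ring.
Qed.

Lemma beta_bounds (m : R) (hm : 0 < m < 1) : 0 < beta m < 1.
Proof.
assert (H : 0 < beta m * (1 - beta m)).
{ rewrite beta_mul. assert (Hs := pow_lt _ 12 (root4_pos m)).
  assert (0 < m ^ 2) by (apply pow_lt; lra).
  assert (0 < (1 - m) ^ 2) by (apply pow_lt; lra).
  apply Rdiv_lt_0_compat; nra. }
nra.
Qed.

Lemma root4_0 : root4 0 = 1.
Proof. unfold root4. rewrite Rminus_0_r, pow_i, Rplus_0_r, !sqrt_1 by auto. reflexivity. Qed.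

Lemma beta_0 : beta 0 = 0.
Proof. unfold beta. rewrite root4_0. field. Qed.

Lemma is_derive_beta_closed (m : R) : is_derive beta m (27 * m * (1 - m) / (8 * root4 m ^ 10)).
Proof.
assert (Hs := root4_pos m). assert (H4 := root4_pow4 m).
unfold beta. auto_derive.
- split; [eexists; apply is_derive_root4|split; [|trivial]].
  assert (H6 := pow_lt _ 6 Hs). simpl in H6. lra.
- rewrite Derive_root4. field_simplify_eq [H4]; [ring|lra].
Qed.

(** Here [beta (1 - beta)] is kept as a factor, to cancel the singular coefficient of the
    hypergeometric equations under the chain rule. *)
Lemma is_derive_beta (m : R) (hm : 0 < m < 1) :
  is_derive beta m (2 * root4 m ^ 2 * (beta m * (1 - beta m)) / (m * (1 - m))).
Proof.
evar_last; [apply is_derive_beta_closed|].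
rewrite beta_mul. assert (Hs := root4_pos m). field. lra.
Qed.

(** * The elliptic solution of the system *)

Definition modK (m : R) : R := root4 m * intK m.

(* The theorem, solved for [E_s]: [10 - 10 modE / modK] is
   [1 + 8 beta - (m - 2 + 3 intE / intK) / sqrt (1 - m + m^2)]. *)
Definition modE (m : R) : R :=
  root4 m * (intK m * (9 - 8 * beta m) + ((m - 2) * intK m + 3 * intE m) / root4 m ^ 2) / 10.

(** This is [(5/6) beta' / (beta (1 - beta))], the coefficient that the chain rule produces from the
    contiguous relations with [b = 5/6]. *)
Definition sys_u (m : R) : R := 5 / 3 * root4 m ^ 2 / (m * (1 - m)).

Lemma Derive_intK (m : R) (hm : 0 < m < 1) :
  Derive (fun t => intK t) m = (intE m - (1 - m) * intK m) / (2 * m * (1 - m)).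
Proof. apply is_derive_unique, is_derive_intK; lra. Qed.

Lemma Derive_intE (m : R) (hm : 0 < m < 1) :
  Derive (fun t => intE t) m = (intE m - intK m) / (2 * m).
Proof. apply is_derive_unique, is_derive_intE; lra. Qed.

Lemma Derive_beta (m : R) :
  Derive (fun t => beta t) m = 27 * m * (1 - m) / (8 * root4 m ^ 10).
Proof. apply is_derive_unique, is_derive_beta_closed. Qed.

Lemma is_derive_modK (m : R) (hm : 0 < m < 1) :
  is_derive modK m (sys_u m * (modE m - (1 - beta m) * modK m)).
Proof.
assert (Hs := root4_pos m). assert (H4 := root4_pow4 m).
unfold modK at 1. auto_derive.
- split; [eexists; apply is_derive_root4|split; [|trivial]].
  eexists. apply is_derive_intK; lra.
- rewrite Derive_root4, Derive_intK by exact hm.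
  unfold sys_u, modE, modK, beta.
  field_simplify_eq [H4]; [ring|lra].
Qed.

Lemma beta_reduced (m : R) :
  beta m = 1 / 2 - (1 + m) * (1 - 2 * m) * (2 - m) / (4 * root4 m ^ 2 * (1 - m + m ^ 2)).
Proof. unfold beta. rewrite <- root4_pow4. assert (Hs := root4_pos m). field. lra. Qed.

Lemma Derive_beta_reduced (m : R) :
  Derive (fun t => beta t) m = 27 * m * (1 - m) / (8 * root4 m ^ 2 * (1 - m + m ^ 2) ^ 2).
Proof. rewrite Derive_beta, <- root4_pow4. assert (Hs := root4_pos m). field. lra. Qed.

Lemma Derive_root4_reduced (m : R) :
  Derive (fun t => root4 t) m = (2 * m - 1) * root4 m / (4 * (1 - m + m ^ 2)).
Proof. rewrite Derive_root4, <- root4_pow4. assert (Hs := root4_pos m). field. lra. Qed.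

(* The derivative of [modE] with [q^4] eliminated from every denominator but a power of [q^2];
   otherwise [field] meets powers of [q] too large to be normalized. *)
Lemma modE_algebra (m q k e : R) (hm : 0 < m < 1) (hq : 0 < q) (hp : q ^ 4 = 1 - m + m ^ 2) :
  let p := 1 - m + m ^ 2 in
  let b := 1 / 2 - (1 + m) * (1 - 2 * m) * (2 - m) / (4 * q ^ 2 * p) in
  let k' := (e - (1 - m) * k) / (2 * m * (1 - m)) in
  let e' := (e - k) / (2 * m) in
  let b' := 27 * m * (1 - m) / (8 * q ^ 2 * p ^ 2) in
  let q' := (2 * m - 1) * q / (4 * p) in
  (q' * k * (9 - 8 * b) + q * k' * (9 - 8 * b) - 8 * q * k * b'
    + (k + (m - 2) * k' + 3 * e') / q - ((m - 2) * k + 3 * e) * q' / q ^ 2) / 10 =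
  5 / 3 * q ^ 2 / (m * (1 - m)) * (1 - b) *
    (q * (k * (9 - 8 * b) + ((m - 2) * k + 3 * e) / q ^ 2) / 10 - q * k).
Proof.
intros p b k' e' b' q'.
assert (Hp : 0 < 1 - m + m ^ 2) by nra.
unfold q', b', e', k', b, p.
field_simplify_eq; [|lra]. rewrite !hp. ring.
Qed.

Lemma is_derive_modE (m : R) (hm : 0 < m < 1) :
  is_derive modE m (sys_u m * (1 - beta m) * (modE m - modK m)).
Proof.
assert (Hs := root4_pos m).
assert (A := modE_algebra m (root4 m) (intK m) (intE m) hm Hs (root4_pow4 m)).
cbv zeta in A.
rewrite <- beta_reduced, <- Derive_root4_reduced, <- Derive_intK, <- Derive_intE,
  <- Derive_beta_reduced in A by exact hm.
unfold modE at 1. auto_derive.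
- assert (dS : ex_derive (fun t => root4 t) m) by (eexists; apply is_derive_root4).
  assert (dB : ex_derive (fun t => beta t) m) by (eexists; apply is_derive_beta_closed).
  assert (dK : ex_derive (fun t => intK t) m) by (eexists; apply is_derive_intK; lra).
  assert (dE : ex_derive (fun t => intE t) m) by (eexists; apply is_derive_intE; lra).
  exact (conj dS (conj dK (conj dB (conj dK (conj dE (conj dS
    (conj (Rgt_not_eq _ _ (pow_lt _ 2 Hs)) I))))))).
- unfold sys_u, modE, modK. rewrite <- A. field. lra.
Qed.

(** Covers [m = 0], where [sys_u] is singular; it provides continuity up to the initial point. *)
Lemma ex_derive_modK (m : R) (hm : m < 1) : ex_derive modK m.
Proof.
apply (ex_derive_mult root4 intK); [eexists; apply is_derive_root4|].
eexists. now apply is_derive_intK_param.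
Qed.

Lemma ex_derive_modE (m : R) (hm : m < 1) : ex_derive modE m.
Proof.
assert (Hs := root4_pos m).
unfold modE. auto_derive.
assert (dS : ex_derive (fun t => root4 t) m) by (eexists; apply is_derive_root4).
assert (dB : ex_derive (fun t => beta t) m) by (eexists; apply is_derive_beta_closed).
assert (dK : ex_derive (fun t => intK t) m) by (eexists; now apply is_derive_intK_param).
assert (dE : ex_derive (fun t => intE t) m) by (eexists; now apply is_derive_intE_param).
exact (conj dS (conj dK (conj dB (conj dK (conj dE (conj dS
  (conj (Rgt_not_eq _ _ (pow_lt _ 2 Hs)) I))))))).
Qed.

Lemma beta_unit (m : R) (hm : 0 <= m < 1) : Rabs (beta m) < 1.
Proof.
destruct (Req_dec m 0) as [->|H0]; [rewrite beta_0, Rabs_R0; lra|].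
assert (H := beta_bounds m ltac:(lra)). rewrite Rabs_pos_eq; lra.
Qed.

(** * The hypergeometric solution and the modular transformation *)

Lemma ex_derive_F21 (a b x : R) (ha : Rabs a <= 1) (hb : Rabs b <= 1)
  (hx : Rabs x < 1) : ex_derive (F21 a b 1) x.
Proof. eexists. now apply is_derive_F21. Qed.

Lemma is_derive_F21_beta (a b m : R) (ha : Rabs a <= 1) (hb : Rabs b <= 1) (hm : 0 < m < 1) :
  is_derive (fun t => F21 a b 1 (beta t)) m
    (2 * root4 m ^ 2 * (beta m * (1 - beta m)) / (m * (1 - m)) * Derive (F21 a b 1) (beta m)).
Proof.
apply (is_derive_comp (F21 a b 1) beta); [|now apply is_derive_beta].
apply Derive_correct, ex_derive_F21; trivial. apply beta_unit; lra.
Qed.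

Lemma continuous_F21_beta (a b m : R) (ha : Rabs a <= 1) (hb : Rabs b <= 1) (hm : 0 <= m < 1) :
  continuous (fun t => F21 a b 1 (beta t)) m.
Proof.
apply (continuous_comp beta (F21 a b 1)).
{ apply (ex_derive_continuous (V := R_NormedModule)). eexists. apply is_derive_beta_closed. }
apply (ex_derive_continuous (V := R_NormedModule)), ex_derive_F21; trivial.
now apply beta_unit.
Qed.

(** The system is applied with [w = 1 - beta]. The constant [2 / PI] comes from [m = 0], where the
    hypergeometric series is 1 and [modK] is [PI / 2]. *)
Lemma modular_transformation (m : R) (hm : 0 < m < 1) :
  F21 (1 / 6) (5 / 6) 1 (beta m) * modE m = modK m * F21 (- (5 / 6)) (5 / 6) 1 (beta m) /\
  F21 (1 / 6) (5 / 6) 1 (beta m) = 2 / PI * modK m.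
Proof.
assert (A1 : Rabs (1 / 6) <= 1) by (rewrite Rabs_pos_eq; lra).
assert (A5 : Rabs (5 / 6) <= 1) by (rewrite Rabs_pos_eq; lra).
assert (A6 : Rabs (- (5 / 6)) <= 1) by (rewrite Rabs_Ropp; exact A5).
assert (Kpos : forall t, t < 1 -> 0 < modK t).
{ intros t Ht. apply Rmult_lt_0_compat; [apply root4_pos|now apply intK_pos]. }
assert (K0 : modK 0 = PI / 2) by (unfold modK; rewrite root4_0, intK_0; ring).
destruct (linear_system_unique sys_u (fun t => 1 - beta t)
  (fun t => F21 (1 / 6) (5 / 6) 1 (beta t)) (fun t => F21 (- (5 / 6)) (5 / 6) 1 (beta t))
  modK modE m ltac:(lra)) as [H1 H2].
- intros t Ht. apply continuous_F21_beta; trivial; lra.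
- intros t Ht. apply continuous_F21_beta; trivial; lra.
- intros t Ht. apply (ex_derive_continuous (V := R_NormedModule)), ex_derive_modK; lra.
- intros t Ht. apply (ex_derive_continuous (V := R_NormedModule)), ex_derive_modE; lra.
- intros t Ht. evar_last; [apply is_derive_F21_beta; trivial; lra|].
  assert (B := beta_bounds t ltac:(lra)).
  assert (D := F21_derive (5 / 6) (beta t) ltac:(lra) ltac:(apply beta_unit; lra)).
  replace (1 - 5 / 6) with (1 / 6) in D by field.
  unfold sys_u. cbv beta.
  (* Regrouped to expose the left-hand side of [F21_derive] at [beta t]. *)
  transitivity (2 * root4 t ^ 2 / (t * (1 - t)) *
    (beta t * (1 - beta t) * Derive (F21 (1 / 6) (5 / 6) 1) (beta t))); [field; lra|].
  rewrite D. field. lra.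
- intros t Ht. evar_last; [apply is_derive_F21_beta; trivial; lra|].
  assert (B := beta_bounds t ltac:(lra)).
  assert (D := F21_lower_derive (5 / 6) (beta t) ltac:(lra) ltac:(apply beta_unit; lra)).
  replace (1 - 5 / 6) with (1 / 6) in D by field.
  unfold sys_u. cbv beta.
  transitivity (2 * root4 t ^ 2 / (t * (1 - t)) * (1 - beta t) *
    (beta t * Derive (F21 (- (5 / 6)) (5 / 6) 1) (beta t))); [field; lra|].
  rewrite D. field. lra.
- intros t Ht. apply is_derive_modK; lra.
- intros t Ht. apply is_derive_modE; lra.
- intros t Ht. apply Kpos; lra.
- cbv beta. rewrite beta_0, !F21_0. reflexivity.
(* At 0 the bracket in [modE] is [(9 - 2 + 3) PI / 2], so division by 10 gives [modK 0]. *)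
- unfold modE, modK. rewrite root4_0, intK_0, intE_0, beta_0. field.
- split; [exact H1|].
  rewrite beta_0, F21_0, K0 in H2.
  assert (Hk := Kpos m ltac:(lra)). assert (HPI := PI_RGT_0).
  apply Rmult_eq_reg_r with (/ modK m); [|apply Rinv_neq_0_compat; lra].
  etransitivity; [exact H2|]. field. lra.
Qed.

(** * Identification of the generalized singular value and conclusion *)

(** [F] is positive and increasing, so [F (1 - x) / F x] is strictly decreasing. *)
Lemma F21_ratio_inj (x y : R) (hx : 0 < x < 1) (hy : 0 < y < 1)
  (h : F21 (1 / 6) (5 / 6) 1 (1 - x) / F21 (1 / 6) (5 / 6) 1 x =
       F21 (1 / 6) (5 / 6) 1 (1 - y) / F21 (1 / 6) (5 / 6) 1 y) : x = y.
Proof.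
set (F := F21 (1 / 6) (5 / 6) 1) in *.
assert (inc : forall s t, 0 <= s < t -> t < 1 -> F s < F t).
{ intros s t Hs Ht. apply F21_increasing; lra. }
assert (pos : forall t, 0 < t < 1 -> 0 < F t).
{ intros t Ht. apply Rlt_trans with (F 0); [unfold F; rewrite F21_0; lra|apply inc; lra]. }
assert (dec : forall s t, 0 < s < t -> t < 1 -> F (1 - t) / F t < F (1 - s) / F s).
{ intros s t Hs Ht.
  assert (P1 := pos s ltac:(lra)). assert (P2 := inc s t ltac:(lra) Ht).
  assert (P3 := pos (1 - t) ltac:(lra)). assert (P4 := inc (1 - t) (1 - s) ltac:(lra) ltac:(lra)).
  apply Rmult_lt_reg_r with (F s * F t); [nra|].
  replace (F (1 - t) / F t * (F s * F t)) with (F (1 - t) * F s) by (field; lra).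
  replace (F (1 - s) / F s * (F s * F t)) with (F (1 - s) * F t) by (field; lra).
  nra. }
destruct (Rtotal_order x y) as [H|[H|H]]; [|exact H|].
- assert (D := dec x y ltac:(lra) ltac:(lra)). lra.
- assert (D := dec y x ltac:(lra) ltac:(lra)). lra.
Qed.

Theorem theorem3p2 (r k b : R) (hr : 0 < r)
  (hk : is_singular_modulus r k) (hb : is_beta r b) :
  10 * alpha_s (1/3) r (sqrt b) / sqrt r =
  1 + 8 * b
  - (1 + k ^ 2 - 3 * alpha_fun r k / sqrt r) / sqrt (1 - k ^ 2 + k ^ 4).
Proof.
destruct hk as [hk01 hk]. destruct hb as [hb01 hb].
set (m := k ^ 2).
assert (hm : 0 < m < 1) by (unfold m; nra).
assert (HKk : ellK k = intK m) by reflexivity.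
assert (HEk : ellE k = intE m) by reflexivity.
assert (HKk' : ellK (sqrt (1 - k ^ 2)) = intK (1 - m)).
{ unfold ellK, intK. rewrite pow2_sqrt by (fold m; lra). reflexivity. }
destruct (modular_transformation m hm) as [HE HF].
destruct (modular_transformation (1 - m) ltac:(lra)) as [_ HF'].
assert (HKp := intK_pos m ltac:(lra)). assert (HS := root4_pos m).
assert (HPI := PI_RGT_0).
assert (Hb : b = beta m).
(* At [beta m] the factors [2 / PI] and [root4], the latter invariant under [m -> 1 - m], cancel
   from the ratio and leave the quotient of elliptic integrals that defines [k]. *)
{ apply F21_ratio_inj; [exact hb01|now apply beta_bounds|].
  rewrite hb, <- hk, <- beta_reflect, HF, HF', HKk, HKk'.
  unfold modK. rewrite root4_reflect. field. lra. }
subst b.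
assert (HEs : F21 (- (5 / 6)) (5 / 6) 1 (beta m) = 2 / PI * modE m).
{ apply Rmult_eq_reg_l with (modK m).
  - rewrite <- HE, HF. ring.
  - unfold modK. apply Rgt_not_eq, Rmult_lt_0_compat; assumption. }
unfold alpha_s, alpha_fun, Ks, Es.
rewrite pow2_sqrt by lra.
replace (1 / 2 - 1 / 3) with (1 / 6) by field.
replace (1 / 2 + 1 / 3) with (5 / 6) by field.
replace (-1 / 2 - 1 / 3) with (- (5 / 6)) by field.
replace (PI * (1 / 3)) with (PI / 3) by field.
(* Since [cos (PI / 3) = 1/2], the weight in [alpha_s] is [3/10], and [Ks^2] becomes
   [sqrt (1 - m + m^2) * intK m ^ 2]; this accounts for the factors 10 and 3 in the identity. *)
rewrite cos_PI3, HF, HEs, HKk, HEk.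
replace (k ^ 4) with (m ^ 2) by (unfold m; ring).
rewrite <- root4_sqr.
unfold modK, modE.
assert (Hr := sqrt_lt_R0 r hr).
field. lra.
Qed.
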